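(* Let $\Delta$ be a spherical building with type set $I$ (associated to a twisted or untwisted Chevalley group of rank at least $2$) and let $\Gamma$ be its $K$-shadow space for a non-empty set $K\subseteq I$. Let $R$ be a $J$-residue of $\Delta$, where $J\subseteq I$. (a) For any dual point $p^{*_R}$ of $\mathcal{P}_{K\cap J}(R)^*$, there is some dual point $p^*$ of $\Gamma^*$ such that $H_{R,K\cap J}(p^{*_R})$ corresponds to $\mathcal{P}_{\Delta,K}(R)\cap H(p^* )$ under the isomorphism $\mathcal{S}_{K\cap J}(R)\cong\mathcal{S}_{\Delta,K}(R)$. (b) If $(e,V)$ is a polarized embedding of $\Gamma$, then the isomorphism $\mathcal{S}_{K\cap J}(R)\cong\mathcal{S}_{\Delta,K}(R)$ composed with $e$ yields a full polarized embedding of $\mathcal{S}_{K\cap J}(R)$ into $\mathbb{P}(V_R)$, where $V_R=\langle e(x)\mid x\in\mathcal{P}_{\Delta,K}(R)\rangle$.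
   Context: Buildings. $\Delta$ is viewed as a chamber system with distance function $\delta:\Delta\times\Delta\to W$, where $(W,\{r_i\}_{i\in I})$ is a finite Coxeter system. For $J\subseteq I$, $W_J=\langle r_j\mid j\in J\rangle$ with longest element $w_J$; the $J$-residue on a chamber $c$ is $\{d\mid\delta(c,d)\in W_J\}$; it is itself a building with type set $J$. Flags of type $L\subseteq J$ of a $J$-residue $R$ are identified with residues of type $J-L$ contained in $R$ (sets of chambers). Shadow spaces. For a $J$-residue $R$ (possibly $R=\Delta$, $J=I$) and $L\subseteq J$, the $L$-shadow space $\mathcal{S}_L(R)=(\mathcal{P}_L(R),\mathcal{L}_L(R))$ has as points the flags of type $L$ of $R$; for each $l\in L$ and each $\{l\}$-residue (panel) $\pi\subseteq R$, the set of points $x$ with $x\cap\pi\ne\emptyset$ is a line. If $L=\emptyset$ there is a single point, $R$ itself. $\Gamma=\mathcal{S}_K(\Delta)=(\mathcal{P},\mathcal{L})$. For a residue $R$ of $\Delta$, $\mathcal{S}_{\Delta,K}(R)$ has point set $\mathcal{P}_{\Delta,K}(R)=\{x\in\mathcal{P}\mid x\cap R\neq\emptyset\}$ and as lines the lines of $\Gamma$ with at least two points in this set. The natural isomorphism $\mathcal{S}_{\Delta,K}(R)\cong\mathcal{S}_{K\cap J}(R)$ is given by $x\mapsto x\cap R$. Opposition. For a $J$-residue $R$: types $i,j\in J$ are opposite if $r_i=w_J^{-1}r_jw_J$, and $\mathrm{opp}_J(L)$ is the set of types in $J$ opposite to some $l\in L$. Chambers $x,y\in R$ are opposite in $R$ if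 $\delta(x,y)=w_J$. For a residue $S\subseteq R$, $\mathrm{opp}_R(S)$ is the set of chambers of $R$ opposite in $R$ to some chamber of $S$, and $\mathrm{near}_R(S)=R-\mathrm{opp}_R(S)$. The geometry dual to $\mathcal{S}_L(R)$ is $\mathcal{S}_L(R)^*=\mathcal{S}_{\mathrm{opp}_J(L)}(R)$, with point set $\mathcal{P}_L(R)^*$; its points are called dual points; $\Gamma^*=\mathcal{S}_K(\Delta)^*$. For $x^*\in\mathcal{P}_L(R)^*$, $H_{R,L}(x^* )=\{x\in\mathcal{P}_L(R)\mid x\cap\mathrm{near}_R(x^* )\neq\emptyset\}$, and $H(p^* )=H_{\Delta,K}(p^* )$. Sets of the form $H_{R,L}(x^* )$ are the singular hyperplanes of $\mathcal{S}_L(R)$. Embeddings. $\mathbb{P}(V)$ is the geometry of 1-spaces and 2-spaces of a vector space $V$. A full projective embedding $(e,V)$ of a point-line geometry is an injective map $e$ from its points to the points of $\mathbb{P}(V)$ such that the image spans $V$ and each line is mapped onto a line of $\mathbb{P}(V)$. A hyperplane $H$ of the geometry is induced by $(e,V)$ if $H=\{x\mid e(x)\subseteq U\}$ for some hyperplane $U$ of $V$. $(e,V)$ is polarized if it is a full projective embedding such that every singular hyperplane is induced by $(e,V)$. *)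

(* Defs.v *)
(* Residues, flags and vector subspaces may be infinite, hence are classical
   sets; sets of types are {set I}. *)
From mathcomp Require Import all_boot all_fingroup all_algebra.
From mathcomp Require Import boolp classical_sets functions.
Set Implicit Arguments.
Unset Strict Implicit.
Unset Printing Implicit Defensive.

Import GRing.Theory.
Local Open Scope classical_set_scope.

Section FiniteCoxeterSystems.
Variables (I : finType) (W : finGroupType) (r : I -> W).

(* [cox_pres] is the universal property of the presentation
   < r_i | (r_i r_j)^(m_ij) = 1 >, where m_ij is the order of r_i r_j in W. *)
Record coxeter_system : Prop := CoxeterSystem {
  cox_gen : (<< r @: [set: I]%SET >> = [set: W]%SET)%g;
  cox_inj : injective r;
  cox_invol : forall i, #[r i]%g = 2;
  cox_pres : forall (G : groupType) (f : I -> G),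
    (forall i j, ((f i * f j) ^+ #[r i * r j] = 1)%g) ->
    exists2 phi : W -> G, {morph phi : x y / (x * y)%g} & phi \o r =1 f
}.

Definition word_val (s : seq I) : W := (\prod_(i <- s) r i)%g.

(* Every element of a group generated by the involutions r_i is a product of
   fewer than #|W| of them, so [iota 0 #|W|] contains the least such number. *)
Definition wlen (w : W) : nat :=
  find (fun n => [exists s : n.-tuple I, word_val s == w]) (iota 0 #|W|).

Definition reduced (s : seq I) : bool := wlen (word_val s) == size s.

Definition parabolic (J : {set I}) : {set W} := (<< r @: J >>)%g.

Definition longest (J : {set I}) : W :=
  [arg max_(w > 1%g in parabolic J) wlen w]%N.

(* Types in J opposite, relative to J, to some type in L:
   r_i = w_J^-1 r_l w_J; in MathComp [x ^ y] is y^-1 * x * y. *)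
Definition opp_types (J L : {set I}) : {set I} :=
  [set i in J | [exists l in J :&: L, r i == (r l ^ longest J)%g]]%SET.

End FiniteCoxeterSystems.

Section Buildings.
Variables (I : finType) (W : finGroupType) (r : I -> W).
Variables (D : Type) (adj : I -> D -> D -> Prop) (delta : D -> D -> W).

(* Galleries do not stutter; otherwise deltaP below would be contradictory. *)
Fixpoint gallery (s : seq I) (c d : D) : Prop :=
  if s is i :: s' then
    exists c', [/\ adj i c c', c <> c' & gallery s' c' d]
  else c = d.

Record building : Prop := Building {
  adj_equiv : forall i, RelationClasses.Equivalence (adj i);
  panel_ge2 : forall i c, exists2 d, adj i c d & c <> d;
  deltaP : forall s c d, reduced r s ->
    (delta c d = word_val r s <-> gallery s c d)
}.

Definition residue (J : {set I}) (R : set D) : Prop :=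
  exists c, R = [set d | delta c d \in parabolic r J].

End Buildings.

Record plgeom (T : Type) := PLGeom {
  points : set T;
  lines : set (set T)
}.

Section ShadowSpaces.
Variables (I : finType) (W : finGroupType) (r : I -> W).
Variables (D : Type) (delta : D -> D -> W).
Implicit Types (J L K : {set I}) (R S : set D).

(* S_L(R) for a J-residue R and L \subset J: flags of type L of R are the
   residues of type J - L contained in R. *)
Definition shadow J R L : plgeom (set D) :=
  let P := [set x | residue r delta (J :\: L) x /\ x `<=` R] in
  PLGeom P
    [set M | exists l pi, [/\ l \in L, residue r delta [set l]%SET pi,
               pi `<=` R & M = [set x | P x /\ x `&` pi !=set0]]].

Definition Gamma K : plgeom (set D) := shadow [set: I]%SET setT K.

(* S_{Delta,K}(R); its lines are whole lines of Gamma. *)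
Definition subshadow K R : plgeom (set D) :=
  let P := [set x | points (Gamma K) x /\ x `&` R !=set0] in
  PLGeom P
    [set M | lines (Gamma K) M /\
       exists x y, [/\ x <> y, P x /\ M x & P y /\ M y]].

(* The isomorphism x |-> x `&` R from S_{Delta,K}(R) to S_{K :&: J}(R), and
   its inverse. *)
Definition cut R (x : set D) : set D := x `&` R.

Definition uncut K R : set D -> set D :=
  'pinv_id (points (subshadow K R)) (cut R).

Definition opp_chambers J R S : set D :=
  [set c | R c /\ exists2 d, S d & delta c d = longest r J].

Definition near_chambers J R S : set D := R `\` opp_chambers J R S.

(* S_L(R)^*; its points are the dual points of S_L(R). *)
Definition dual_shadow J R L : plgeom (set D) :=
  shadow J R (opp_types r J L).

Definition sing_hyp J R L (xs : set D) : set (set D) :=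
  [set x | points (shadow J R L) x /\ x `&` near_chambers J R xs !=set0].

End ShadowSpaces.

Definition division_ring (F : unitRingType) : Prop :=
  forall a : F, a != 0%R -> a \is a GRing.unit.

Section ProjectiveEmbeddings.
Local Open Scope ring_scope.
Variables (F : unitRingType) (V : lmodType F).
Implicit Types (E U X : set V).

Definition is_subspace U : Prop :=
  U 0 /\ forall (a : F) u v, U u -> U v -> U (a *: u + v).

Definition span (A : set V) : set V := smallest is_subspace A.

Definition is_hyperplane E U : Prop :=
  [/\ is_subspace U, U `<=` E &
      exists2 v, (E `\` U) v & span (U `|` [set v]) = E].

Definition space1 X : Prop := exists2 v, v != 0 & X = span [set v].

Definition space2 X : Prop := exists u v,
  [/\ u != 0, ~ span [set u] v & X = span [set u; v]].

(* The projective geometry of a subspace E of V (E = setT for that of V).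
   The vector space carrying an embedding is always given as a subspace of an
   ambient V, so that V_R = <e(x) | x> can be treated like V itself. *)
Definition proj_space E : plgeom (set V) :=
  PLGeom [set X | space1 X /\ X `<=` E]
    [set M | exists Y, [/\ space2 Y, Y `<=` E &
               M = [set X | space1 X /\ X `<=` Y]]].

Definition image_span (T : Type) (P : set T) (e : T -> set V) : set V :=
  span (\bigcup_(x in P) e x).

(* Only the values of e on the points of G matter. *)
Record full_embedding (T : Type) (G : plgeom T) E (e : T -> set V) : Prop :=
  FullEmbedding {
    emb_space : is_subspace E;
    emb_points : set_fun (points G) (points (proj_space E)) e;
    emb_inj : set_inj (points G) e;
    emb_span : image_span (points G) e = E;
    emb_lines : forall M, lines G M -> lines (proj_space E) (e @` M)
  }.

Definition induced (T : Type) (G : plgeom T) E (e : T -> set V)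
    (H : set T) : Prop :=
  exists2 U, is_hyperplane E U & H = [set x | points G x /\ e x `<=` U].

(* Polarized embeddings of S_L(R), R a J-residue. *)
Definition polarized (I : finType) (W : finGroupType) (r : I -> W)
    (D : Type) (delta : D -> D -> W) (J : {set I}) (R : set D) (L : {set I})
    E (e : set D -> set V) : Prop :=
  full_embedding (shadow r delta J R L) E e /\
  forall xs, points (dual_shadow r delta J R L) xs ->
    induced (shadow r delta J R L) E e (sing_hyp r delta J R L xs).

End ProjectiveEmbeddings.

(* Main.v *)
Require Import Defs.
From mathcomp Require Import all_boot all_fingroup all_algebra.
From mathcomp Require Import boolp classical_sets functions.
From mathcomp Require Import zify.

(** The geometric content lies in one choice of dual point.  Take a chamber [c]
    of the given dual point of [R] and, writing w_J and w_I for the longest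
    elements of W_J and W, a chamber [d] at distance w_J w_I from [c].  Since
    w_J w_I is the shortest element of its coset W_J w_J w_I, every chamber [b]
    of [R] satisfies delta b d = delta b c * w_J w_I.  Hence [d] is opposite [b]
    in the whole building exactly when [c] is opposite [b] in [R]
    ([opposite_gate]), and the dual point of Gamma containing [d] is the one
    wanted ([extend_dual_point]).

    To compare hyperplanes through single chambers, [sing_hypP] shows that a
    point lies in the singular hyperplane of [xs] exactly when none of its
    chambers is opposite one fixed chamber of [xs]: conjugation by the longest
    element exchanges W_{J - L} and W_{J - opp_J(L)}
    ([conj_longest_parabolic]), so a chamber opposite some chamber of [xs] can
    be traded, inside its own residue, for one opposite any given chamber of
    [xs].  If a point x of Gamma meets both [R] and the opposites of [d], then
    the distance to [d] from a chamber of x in [R] lies both in W_{I - K} w_I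
    and in W_J w_J w_I; as W_{I - K} and W_J meet only in W_{J - K}
    ([parabolicI]), x then has a chamber in [R] opposite [c].

    For polarized embeddings, points and lines of the shadow space of [R] are
    points and lines of Gamma cut down to [R], so the restricted map is again a
    full embedding ([full_embedding_residue]).  A singular hyperplane of [R] is
    cut out by one of Gamma, hence by a hyperplane U of V, and it is proper
    because opposite chambers exist in [R] ([sing_hyp_proper]); thus U does not
    contain the span of the points meeting [R] and meets it in a hyperplane
    ([hyperplane_restrict]).

    All of this rests on the exchange condition for W.  It is derived from the
    presentation of W, by letting W permute W x {+1, -1} so that the sign
    records which reflections are crossed by a word ([refl_perm],
    [refl_sign_delete]). *)

Set Implicit Arguments.
Unset Strict Implicit.
Unset Printing Implicit Defensive.

Local Open Scope classical_set_scope.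

(** * Words, parabolic subgroups and length *)

Section Words.
Local Open Scope group_scope.
Variables (I : finType) (W : finGroupType) (r : I -> W).
Implicit Types (s : seq I) (w : W) (J : {set I}).

Lemma word_val_cons i s : word_val r (i :: s) = r i * word_val r s.
Proof. by rewrite /word_val big_cons. Qed.

Lemma word_val_cat s t : word_val r (s ++ t) = word_val r s * word_val r t.
Proof. by rewrite /word_val big_cat. Qed.

Lemma parabolicP J w :
  reflect (exists2 s, all [in J] s & word_val r s = w) (w \in parabolic r J).
Proof.
apply: (iffP idP) => [/gen_prodgP [n [c cJ ->]]|[s sJ <-]].
  pose P := fun w => exists2 s, all [in J] s & word_val r s = w.
  apply: (big_ind P) => [|x y [s sJ <-] [t tJ <-]|i _].
  - by exists [::] => //; rewrite /word_val big_nil.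
  - by exists (s ++ t); rewrite ?all_cat ?sJ // word_val_cat.
  - have /imsetP [j jJ ->] := cJ i.
    by exists [:: j]; rewrite /= ?jJ // /word_val big_seq1.
rewrite /word_val big_seq; apply: group_prod => i si.
by apply/mem_gen/imset_f; apply: (allP sJ).
Qed.

(** Among #|W| + 1 prefixes two have the same value, and the piece between them
    can be cut out; this is what makes the bounded search in [wlen] succeed. *)
Lemma short_word s :
  exists2 s', word_val r s' = word_val r s & size s' < #|W|.
Proof.
have [n] := ubnP (size s); elim: n s => // n IHn s s_n.
have [|W_s] := ltnP (size s) #|W|; first by exists s.
pose f (k : 'I_(size s).+1) := word_val r (take k s).
have /injectivePn [a [b a_b fab]] : ~~ injectiveb f.
  by apply/negP => /injectiveP /leq_card; rewrite card_ord ltnNge W_s.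
wlog lt_ab : a b a_b fab / a < b.
  move=> IH; have [ab|ba|/val_inj ab] := ltngtP a b; first exact: (IH a b).
    by apply: (IH b a); rewrite 1?eq_sym.
  by rewrite ab eqxx in a_b.
have [|s' s'E s'_W] := IHn (take a s ++ drop b s).
- rewrite size_cat size_takel ?size_drop; last exact: ltn_ord a.
  by have := ltn_ord b; lia.
- exists s' => //; rewrite s'E word_val_cat -/(f a) fab -word_val_cat.
  by rewrite cat_take_drop.
Qed.

Lemma wlen_le s : wlen r (word_val r s) <= size s.
Proof.
have [W_s|s_W] := leqP #|W| (size s).
  by apply: leq_trans W_s; rewrite -[leqRHS](size_iota 0) find_size.
rewrite leqNgt; apply/negP => /(before_find 0); rewrite nth_iota // add0n.
by move=> /existsP []; exists (in_tuple s).
Qed.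

Hypothesis r_gen : (<< r @: [set: I]%SET >> = [set: W]%SET)%g.

Lemma mem_parabolicT w : w \in parabolic r [set: I]%SET.
Proof. by rewrite /parabolic r_gen inE. Qed.

Lemma reduced_word w : exists2 s, reduced r s & word_val r s = w.
Proof.
have /parabolicP [s0 _ <-] := mem_parabolicT w.
have [s <- {s0} s_W] := short_word s0.
have: has (fun n => [exists t : n.-tuple I, word_val r t == word_val r s])
    (iota 0 #|W|).
  apply/hasP; exists (size s); first by rewrite mem_iota.
  by apply/existsP; exists (in_tuple s).
move=> /[dup] has_s /(nth_find 0) /existsP [t /eqP ts].
exists t => //; rewrite /reduced size_tuple ts /wlen.
move: has_s; rewrite has_find size_iota => lt_W.
by rewrite nth_iota.
Qed.

End Words.

(** * The exchange condition and longest elements *)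

Section Exchange.
Local Open Scope group_scope.
Variables (I : finType) (W : finGroupType) (r : I -> W).
Hypothesis hW : coxeter_system r.
Implicit Types (s : seq I) (t w : W) (J : {set I}).

Lemma simple_sq i : r i * r i = 1.
Proof. by rewrite -expg2 -(cox_invol hW i) expg_order. Qed.

Lemma simpleV i : (r i)^-1 = r i.
Proof. by apply/eqP; rewrite eq_invg_mul simple_sq. Qed.

Lemma simpleK i w : r i * (r i * w) = w.
Proof. by rewrite mulgA simple_sq mul1g. Qed.

Lemma conjg_eq x y t : (t ^ x == y) = (t == y ^ x^-1).
Proof. exact: (can2_eq (conjgK x) (conjgKV x)). Qed.

(** The action on reflections by conjugation, with a sign that changes when the
    reflection is [r i] itself.  It is defined on all of W rather than on the
    set of reflections, which makes it a permutation of a group type. *)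
Definition signed_refl i (x : W * bool) := (x.1 ^ r i, x.2 (+) (x.1 == r i)).

Lemma signed_reflK i : involutive (signed_refl i).
Proof.
case=> t b; rewrite /signed_refl /= -conjgM simple_sq conjg1.
by rewrite conjg_eq conjgE invgK mulgV mulg1 addbK.
Qed.

Definition refl_perm i : {perm W * bool} := perm (inv_inj (signed_reflK i)).

(** With g = r i * r j, the sign of [t] changes once for each of the 2n
    reflections g^k r_i crossed by the alternating word of length 2n. *)
Lemma refl_perm_exp i j n x :
  ((refl_perm i * refl_perm j) ^+ n) x =
  (x.1 ^ (r i * r j) ^+ n,
   x.2 (+) \big[addb/false]_(k < n.*2) (x.1 == (r i * r j) ^+ k * r i)).
Proof.
elim: n x => [|n IHn] [t b] /=.
  by rewrite big_ord0 addbF expg0 perm1 conjg1.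
rewrite expgSr permM {}IHn permM !permE /signed_refl /= doubleS !big_ord_recr /=.
set g := r i * r j.
(* [r i] inverts [g], as the two lie in a dihedral group. *)
have gr k : r i * g ^- k = g ^+ k * r i.
  have gri : g ^ r i = g^-1 by rewrite /g invMg !simpleV conjgE simpleV -?mulgA simpleK.
  by rewrite -expgVn -gri -conjXg conjgE simpleV -?mulgA simpleK.
have gnE : (t ^ g ^+ n == r i) = (t == g ^+ n.*2 * r i).
  by rewrite conjg_eq conjgE invgK gr mulgA -expgD addnn.
have gnE' : ((t ^ g ^+ n) ^ r i == r j) = (t == g ^+ n.*2.+1 * r i).
  rewrite 2!conjg_eq simpleV (_ : r j ^ r i = g * r i); last first.
    by rewrite conjgE simpleV mulgA.
  by rewrite conjgE invgK -mulgA gr (mulgA _ g) -expgSr mulgA -expgD addSn addnn.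
by rewrite gnE gnE' !addbA -!conjgM -?mulgA (expgSr _ n).
Qed.

(** When n is the order of g, each reflection g^k r_i is met twice, so the signs
    cancel: the braid relations hold and the action extends to W. *)
Lemma refl_perm_order i j : (refl_perm i * refl_perm j) ^+ #[r i * r j] = 1.
Proof.
apply/permP => -[t b]; rewrite refl_perm_exp perm1 /= expg_order conjg1.
congr pair; rewrite -addnn big_split_ord /=.
under [X in _ (+) (_ (+) X)]eq_bigr => k _ do rewrite expgD expg_order mul1g.
by rewrite addbb addbF.
Qed.

(** The parity of the number of times the gallery of type [s] starting at 1
    crosses the wall of the reflection [t]. *)
Fixpoint refl_sign s t : bool :=
  if s is i :: s' then (t == r i) (+) refl_sign s' (t ^ r i) else false.

(** The parity is read off the permutation of W x bool attached to the value of
    the word, hence depends on that value only. *)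
Lemma refl_sign_word s s' t :
  word_val r s = word_val r s' -> refl_sign s t = refl_sign s' t.
Proof.
have [phi phiM phir] := cox_pres hW refl_perm_order.
have phi1 : phi 1 = 1 by apply: (mulgI (phi 1)); rewrite -phiM !mulg1.
have phiE u x b : phi (word_val r u) (x, b) = (x ^ word_val r u, b (+) refl_sign u x).
  elim: u x b => [|i u IHu] x b.
    by rewrite /word_val big_nil phi1 perm1 conjg1 addbF.
  rewrite word_val_cons phiM permM [phi (r i)](phir i) permE IHu conjgM /=.
  by rewrite addbA.
by move=> ss'; have := phiE s t false; rewrite ss' phiE => -[].
Qed.

(** An odd parity means that the wall of [t] is crossed somewhere; reflecting the
    rest of the gallery in it deletes the letter of that crossing. *)
Lemma refl_sign_delete s t : refl_sign s t ->
  exists s1 i s2, s = s1 ++ i :: s2 /\ t * word_val r s = word_val r (s1 ++ s2).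
Proof.
elim: s t => //= i s IHs t; have [-> _|_] := eqVneq t (r i).
  by exists [::], i, s; rewrite word_val_cons simpleK.
case/IHs => s1 [j [s2 [-> eq_s]]]; exists (i :: s1), j, s2; split=> //.
rewrite /= !word_val_cons -eq_s conjgE simpleV !mulgA; congr (_ * _).
by rewrite simple_sq mul1g.
Qed.

Lemma refl_sign_cat s s' t :
  refl_sign (s ++ s') t = refl_sign s t (+) refl_sign s' (t ^ word_val r s).
Proof.
elim: s t => [|i s IHs] t /=; first by rewrite /word_val big_nil conjg1.
by rewrite IHs word_val_cons conjgM addbA.
Qed.

(** Otherwise the wall of [r i] would be crossed oddly often by every word for
    r_i w, and deleting a letter of a reduced one would make w shorter than
    r_i w. *)
Lemma descent_refl_sign i s :
  wlen r (r i * word_val r s) <= wlen r (word_val r s) -> refl_sign s (r i).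
Proof.
move=> le_w; apply/negPn/negP => /negbTE s_i.
have [s' red_s' s'E] := reduced_word (cox_gen hW) (r i * word_val r s).
have: refl_sign s' (r i).
  rewrite (@refl_sign_word s' (i :: s)) ?word_val_cons //= eqxx.
  by rewrite conjgE mulKg s_i.
case/refl_sign_delete=> s1 [j [s2 [s'12 ]]]; rewrite s'E simpleK => sE.
move: red_s'; rewrite /reduced s'E s'12 size_cat /= addnS => /eqP red_s'.
have := wlen_le r (s1 ++ s2); rewrite -sE size_cat.
by move: le_w; rewrite red_s'; lia.
Qed.

Lemma exchange i s : wlen r (r i * word_val r s) <= wlen r (word_val r s) ->
  exists s1 j s2,
    s = s1 ++ j :: s2 /\ r i * word_val r s = word_val r (s1 ++ s2).
Proof. by move=> /descent_refl_sign /refl_sign_delete. Qed.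

Lemma wlen_reduced s : reduced r s -> wlen r (word_val r s) = size s.
Proof. by move/eqP. Qed.

Lemma wlen1 : wlen r 1 = 0.
Proof.
by apply/eqP; rewrite -leqn0; have := wlen_le r [::]; rewrite /word_val big_nil.
Qed.

Lemma wlenM_le v w : wlen r (v * w) <= wlen r v + wlen r w.
Proof.
have [s red_s <-] := reduced_word (cox_gen hW) v.
have [t red_t <-] := reduced_word (cox_gen hW) w.
by rewrite !wlen_reduced // -size_cat -word_val_cat wlen_le.
Qed.

Lemma word_val_rev s : word_val r (rev s) = (word_val r s)^-1.
Proof.
elim: s => [|i s IHs]; first by rewrite /word_val big_nil invg1.
rewrite rev_cons -cats1 word_val_cat IHs [in RHS]word_val_cons invMg simpleV.
by rewrite {2}/word_val big_seq1.
Qed.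

Lemma wlenV w : wlen r w^-1 = wlen r w.
Proof.
suff le v : wlen r v^-1 <= wlen r v.
  by apply/eqP; rewrite eqn_leq le -{1}(invgK w) le.
have [s red_s <-] := reduced_word (cox_gen hW) v.
by rewrite wlen_reduced // -word_val_rev (leq_trans (wlen_le _ _)) // size_rev.
Qed.

Lemma reduced_rev s : reduced r (rev s) = reduced r s.
Proof. by rewrite /reduced word_val_rev wlenV size_rev. Qed.

Lemma wlen_simple_le i w : wlen r w <= (wlen r (r i * w)).+1.
Proof.
rewrite -{1}(simpleK i w) (leq_trans (wlenM_le _ _)) // -addn1 addnC leq_add2l.
by have := wlen_le r [:: i]; rewrite /word_val big_seq1.
Qed.

(** Lengths differ by at most 1; equality is excluded by the exchange condition,
    which would give a word for r_i w shorter than w. *)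
Lemma wlen_simple i w :
  wlen r (r i * w) = (wlen r w).+1 \/ (wlen r (r i * w)).+1 = wlen r w.
Proof.
have := wlen_simple_le i w; have := wlen_simple_le i (r i * w); rewrite simpleK.
have [s red_s sE] := reduced_word (cox_gen hW) w.
have [|] := leqP (wlen r (r i * w)) (wlen r w); last by lia.
rewrite -sE => /exchange [s1 [j [s2 [s12 eq12]]]].
have := wlen_le r (s1 ++ s2); rewrite -eq12 (wlen_reduced red_s) s12.
by rewrite !size_cat /=; lia.
Qed.

Lemma reduced_cons i s : reduced r s ->
  reduced r (i :: s) = (wlen r (word_val r s) < wlen r (r i * word_val r s)).
Proof.
move=> red_s; rewrite /reduced word_val_cons wlen_reduced //=.
by have := wlen_simple i (word_val r s); rewrite wlen_reduced //; lia.
Qed.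

Lemma reduced_behead i s : reduced r (i :: s) -> reduced r s.
Proof.
rewrite /reduced word_val_cons /= => /eqP red_s; rewrite eqn_leq wlen_le.
have := wlen_simple_le i (r i * word_val r s).
by rewrite simpleK red_s; have := wlen_le r s; lia.
Qed.

Lemma reduced_word_parabolic J w : w \in parabolic r J ->
  exists s, [/\ reduced r s, all [in J] s & word_val r s = w].
Proof.
case/parabolicP=> s sJ <-; elim: s sJ => [_|i s IHs /= /andP [iJ]].
  by exists [::]; split=> //; rewrite /reduced -leqn0 wlen_le.
case/IHs=> t [red_t tJ tE]; have := reduced_cons i red_t.
case: ltnP => [_ red_it|le_it _].
  by exists (i :: t); rewrite /= iJ !word_val_cons tE.
have [t1 [j [t2 [t12 eq12]]]] := exchange le_it; exists (t1 ++ t2).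
move: tJ; rewrite t12 !all_cat /= => /and3P [-> _ ->].
rewrite -eq12 word_val_cons tE; split=> //.
rewrite /reduced -eq12; have [|] := wlen_simple i (word_val r t); first by lia.
by rewrite (wlen_reduced red_t) t12 !size_cat /=; lia.
Qed.

Lemma simple_parabolic J i : (r i \in parabolic r J) = (i \in J).
Proof.
apply/idP/idP => [/reduced_word_parabolic [s [red_s sJ sE]]|iJ]; last first.
  exact/mem_gen/imset_f.
have := wlen_reduced red_s; rewrite sE => size_s.
have: size s <= 1 by rewrite -size_s -[r i]mulg1; have := wlen_le r [:: i];
  rewrite /word_val big_seq1 mulg1.
case: s sJ sE {red_s size_s} => [|j [|//]] /=.
  rewrite /word_val big_nil => _ r1.
  by have := cox_invol hW i; rewrite -r1 order1.
by rewrite /word_val big_seq1 andbT => jJ /(cox_inj hW) <-.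
Qed.

(** Peeling off the first letter of a reduced word of [w] in J: exchanging it
    against a reduced word of [w] in L shows that this letter lies in L too. *)
Lemma parabolicI J L :
  parabolic r (J :&: L) = parabolic r J :&: parabolic r L.
Proof.
apply/eqP; rewrite finset.eqEsubset finset.subsetI.
rewrite !genS ?imsetS ?finset.subsetIl ?finset.subsetIr //=.
apply/fintype.subsetP => w /finset.setIP [/reduced_word_parabolic [s [red_s sJ <-]]].
elim: s red_s sJ => [|i s IHs] red_is /= => [_ _|/andP [iJ sJ]].
  by rewrite /word_val big_nil group1.
move=> /[dup] isL /reduced_word_parabolic [t [red_t tL tE]].
have red_s := reduced_behead red_is.
have iL : i \in L.
  have le_it : wlen r (r i * word_val r t) <= wlen r (word_val r t).
    rewrite tE word_val_cons simpleK -word_val_cons.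
    by rewrite (wlen_reduced red_s) (wlen_reduced red_is) /=.
  have [t1 [j [t2 [t12 eq12]]]] := exchange le_it.
  rewrite -simple_parabolic -(mulgK (word_val r t) (r i)) eq12 groupM ?groupV //.
    apply/parabolicP; exists (t1 ++ t2) => //.
    by move: tL; rewrite t12 !all_cat /= => /and3P [-> _ ->].
  by apply/parabolicP; exists t.
rewrite word_val_cons groupM //; first by rewrite simple_parabolic inE iJ.
apply: IHs => //; rewrite -(simpleK i (word_val r s)) -word_val_cons.
by rewrite groupM // simple_parabolic.
Qed.

(* longest *)
Lemma longest_parabolic J : longest r J \in parabolic r J.
Proof. by rewrite /longest; case: arg_maxnP => //; apply: group1. Qed.

Lemma wlen_longest J w : w \in parabolic r J -> wlen r w <= wlen r (longest r J).
Proof.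
move=> wJ; rewrite /longest; case: arg_maxnP => [|v _ max_v]; [exact: group1|exact: max_v].
Qed.

(** Every element of W_J begins some reduced word of the longest one.  By
    induction w_J = s z with [s] reduced; multiplying by a letter [i] of J
    cannot increase the length, so the wall of [r i] is crossed by s z.  As
    i :: s is reduced the crossing is in [z], and deleting it there gives
    w_J = (i :: s) z' with z' one letter shorter than [z]. *)
Lemma longest_split J u : u \in parabolic r J ->
  wlen r u + wlen r (u^-1 * longest r J) = wlen r (longest r J).
Proof.
case/reduced_word_parabolic => s [red_s sJ <-].
have w0J := longest_parabolic J; set w0 := longest r J in w0J *.
elim: s red_s sJ => [|i s IHs] red_is /=.
  by rewrite /word_val big_nil invg1 mul1g wlen1.
case/andP=> iJ sJ; have red_s := reduced_behead red_is.
have {IHs} := IHs red_s sJ.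
have [z red_z zE] := reduced_word (cox_gen hW) ((word_val r s)^-1 * w0).
have w0E : word_val r (s ++ z) = w0 by rewrite word_val_cat zE mulKVg.
rewrite -zE (wlen_reduced red_s) (wlen_reduced red_z) => size_w0.
have: refl_sign s (r i) (+) refl_sign z (r i ^ word_val r s).
  rewrite -refl_sign_cat; apply: descent_refl_sign.
  by rewrite w0E wlen_longest // groupM // simple_parabolic.
case: (boolP (refl_sign s (r i))) => [/refl_sign_delete|_ /=].
  case=> s1 [j [s2 [s12 eq12]]]; have := wlen_le r (s1 ++ s2).
  rewrite -eq12 -word_val_cons (wlen_reduced red_is) s12 /= !size_cat /=; lia.
case/refl_sign_delete => z1 [j [z2 [z12 eq12]]].
have is_w0 : (word_val r (i :: s))^-1 * w0 = word_val r (z1 ++ z2).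
  rewrite -w0E word_val_cat word_val_cons -eq12 conjgE invMg simpleV.
  by rewrite !mulgA.
have := wlen_le r (z1 ++ z2); rewrite -is_w0 => le_z.
have := wlenM_le (word_val r (i :: s)) ((word_val r (i :: s))^-1 * w0).
rewrite mulKVg (wlen_reduced red_is) -size_w0 z12 /= !size_cat /=.
by move: le_z; rewrite size_cat; lia.
Qed.

Lemma wlen_eq0 w : wlen r w = 0 -> w = 1.
Proof.
have [s red_s <-] := reduced_word (cox_gen hW) w.
by rewrite wlen_reduced // => /size0nil ->; rewrite /word_val big_nil.
Qed.

Lemma longestV J : (longest r J)^-1 = longest r J.
Proof.
have w0J := longest_parabolic J.
have := @longest_split J (longest r J)^-1; rewrite groupV wlenV => /(_ w0J).
by rewrite invgK => w0; apply/eqP; rewrite eq_invg_mul; apply/eqP/wlen_eq0; lia.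
Qed.

Lemma longestK J w : w * longest r J * longest r J = w.
Proof. by rewrite -{2}longestV mulgK. Qed.

Lemma wlen_conj_longest J u : u \in parabolic r J ->
  wlen r (u ^ longest r J) = wlen r u.
Proof.
move=> uJ; have w0J := longest_parabolic J.
have := @longest_split J (u * longest r J); rewrite groupM // => /(_ isT).
have := longest_split (groupVr uJ); rewrite wlenV invgK.
have -> : (u * longest r J)^-1 * longest r J = (u ^ longest r J)^-1.
  by rewrite -conjVg conjgE invMg mulgA.
by rewrite wlenV => <- /eqP; rewrite addnC eqn_add2r => /eqP.
Qed.

Lemma conj_longest_simple J i : i \in J ->
  exists2 k, k \in J & r i ^ longest r J = r k.
Proof.
move=> iJ; have riJ : r i \in parabolic r J by rewrite simple_parabolic.
have [s [red_s sJ sE]] : exists s, [/\ reduced r s, all [in J] s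
    & word_val r s = r i ^ longest r J].
  by apply: reduced_word_parabolic; rewrite groupJ // longest_parabolic.
have : size s <= 1.
  rewrite -(wlen_reduced red_s) sE wlen_conj_longest //.
  by have := wlen_le r [:: i]; rewrite /word_val big_seq1.
case: s sJ sE {red_s} => [|k [|//]] /= kJ; rewrite /word_val.
  rewrite big_nil => /esym /eqP; rewrite conjg_eq1 => /eqP r1.
  by have := cox_invol hW i; rewrite r1 order1.
by rewrite big_seq1 => rk; exists k => //; case/andP: kJ.
Qed.

(** Conjugation by the longest element permutes the simple reflections of J
    ([conj_longest_simple]), and [opp_types] is this permutation. *)
Lemma conj_longest_parabolic J L u :
  (u ^ longest r J \in parabolic r (J :\: opp_types r J L)) =
  (u \in parabolic r (J :\: L)).
Proof.
have sub (A B : {set I}) v : (forall i, i \in A -> r i ^ longest r J \in parabolic r B) ->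
    v \in parabolic r A -> v ^ longest r J \in parabolic r B.
  move=> AB /parabolicP [s + <-]; elim: s => [|i s IHs] /=.
    by rewrite /word_val big_nil conj1g.
  by case/andP=> iA sA; rewrite word_val_cons conjMg groupM ?AB ?IHs.
have conjK v : (v ^ longest r J) ^ longest r J = v.
  by rewrite -conjgM -{2}longestV mulgV conjg1.
apply/idP/idP; last first.
  apply: sub => i /finset.setDP [iJ iL]; have [k kJ ik] := conj_longest_simple iJ.
  rewrite ik simple_parabolic inE kJ andbT; apply: contra iL.
  rewrite inE kJ => /existsP [l /andP [/finset.setIP [_ lL]]].
  by rewrite -ik => /eqP /conjg_inj /(cox_inj hW) ->.
rewrite -[X in _ -> X \in _]conjK; apply: sub => i /finset.setDP [iJ iL].
have [k kJ ik] := conj_longest_simple iJ.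
rewrite ik simple_parabolic inE kJ andbT; apply: contra iL => kL.
rewrite inE iJ; apply/existsP; exists k.
by rewrite inE kJ kL -ik conjK eqxx.
Qed.

End Exchange.

(** * Distance and residues in a building *)

Section Buildings.
Local Open Scope group_scope.
Variables (I : finType) (W : finGroupType) (r : I -> W).
Variables (D : Type) (adj : I -> D -> D -> Prop) (delta : D -> D -> W).
Hypotheses (hW : coxeter_system r) (hD : building r adj delta).
Implicit Types (s : seq I) (w : W) (J L K : {set I}) (a b c d : D).
Implicit Types (R x y p : set D).

Lemma gallery_cat s t a b c :
  gallery adj s a b -> gallery adj t b c -> gallery adj (s ++ t) a c.
Proof.
elim: s a => [|i s IHs] a /= => [->|[a' [aa' a_a' a'b]] bc] //.
by exists a'; split=> //; apply: IHs.
Qed.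

Lemma gallery1 i a b : adj i a b -> a <> b -> gallery adj [:: i] a b.
Proof. by move=> ab a_b; exists b; split. Qed.

Lemma gallery_rev s a b : gallery adj s a b -> gallery adj (rev s) b a.
Proof.
elim: s a => [|i s IHs] a /= => [-> //|[a' [aa' a_a' /IHs ba']]].
rewrite rev_cons -cats1; apply: gallery_cat ba' _; apply: gallery1.
  by case: (adj_equiv hD i) => _ sym_i _; apply: sym_i.
by move/esym.
Qed.

Lemma deltaV a b : delta b a = (delta a b)^-1.
Proof.
have [s red_s sE] := reduced_word (cox_gen hW) (delta a b).
rewrite -sE -(word_val_rev hW); apply/(deltaP hD); first by rewrite reduced_rev.
by apply: gallery_rev; apply/(deltaP hD).
Qed.

Lemma delta_refl a : delta a a = 1.
Proof.
have -> : 1 = word_val r [::] by rewrite /word_val big_nil.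
by apply/(deltaP hD) => //; rewrite /reduced -leqn0 wlen_le.
Qed.

Lemma delta_surj a w : exists b, delta a b = w.
Proof.
have [s red_s <-] := reduced_word (cox_gen hW) w.
suff [b ab] : exists b, gallery adj s a b by exists b; apply/(deltaP hD).
elim: s a {red_s} => [|i s IHs] a /=; first by exists a.
have [a' aa' a_a'] := panel_ge2 hD i a.
by have [b a'b] := IHs a'; exists b, a'.
Qed.

Lemma deltaM a b c : wlen r (delta a b * delta b c) =
  wlen r (delta a b) + wlen r (delta b c) -> delta a c = delta a b * delta b c.
Proof.
have [s red_s sE] := reduced_word (cox_gen hW) (delta a b).
have [t red_t tE] := reduced_word (cox_gen hW) (delta b c).
rewrite -sE -tE -word_val_cat (wlen_reduced red_s) (wlen_reduced red_t).
rewrite -size_cat => /eqP red_st; apply/(deltaP hD) => //.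
by apply: (@gallery_cat _ _ _ b); apply/(deltaP hD).
Qed.

(** Either a geodesic from [a] to [c] can start by stepping to [b], or a geodesic
    from [b] to [c] leaves their common panel through a chamber which is [a]
    itself or is equally the next one on a geodesic from [a]. *)
Lemma delta_adj i a b c : adj i a b -> a <> b ->
  delta a c = delta b c \/ delta a c = r i * delta b c.
Proof.
move=> ab a_b; have [s red_s sE] := reduced_word (cox_gen hW) (delta b c).
have bc : gallery adj s b c by apply/(deltaP hD).
have [red_is|] := boolP (reduced r (i :: s)).
  right; rewrite -sE -word_val_cons; apply/(deltaP hD) => //.
  exact: (gallery_cat (gallery1 ab a_b) bc).
rewrite (reduced_cons hW) // -leqNgt.
have [t red_t tE] := reduced_word (cox_gen hW) (r i * word_val r s).
have sE' : word_val r s = word_val r (i :: t).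
  by rewrite word_val_cons tE (simpleK hW).
have [wlen_is|wlen_is] := wlen_simple hW i (word_val r s); first by rewrite wlen_is; lia.
move=> _; have red_it : reduced r (i :: t).
  by rewrite /reduced -sE' -wlen_is -tE (wlen_reduced red_t).
have [b' [bb' b_b' b'c]] : gallery adj (i :: t) b c.
  by apply/(deltaP hD); rewrite // -sE -sE'.
have [/= refl_i sym_i trans_i] := adj_equiv hD i.
have [ab'|a_b'] := pselect (a = b').
  right; rewrite -sE -tE; apply/(deltaP hD) => //.
  by rewrite ab'.
left; rewrite -sE sE'; apply/(deltaP hD) => //.
by exists b'; split=> //; apply: trans_i bb'.
Qed.

Lemma delta_coset J a b c : delta a b \in parabolic r J ->
  exists2 u, u \in parabolic r J & delta a c = u * delta b c.
Proof.
case/(reduced_word_parabolic hW) => s [red_s sJ /esym/(deltaP hD a b red_s)].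
elim: s a sJ {red_s} => [|i s IHs] a /= => [_ ->|/andP [iJ sJ] [a' [aa' a_a' /IHs]]].
  by exists 1; rewrite ?group1 ?mul1g.
case=> // u uJ a'c; have riJ : r i \in parabolic r J by rewrite simple_parabolic.
have [->|->] := delta_adj c aa' a_a'; first by exists u.
by exists (r i * u); rewrite ?groupM // -mulgA a'c.
Qed.

Definition res J c : set D := [set d | delta c d \in parabolic r J].

Lemma mem_res J c : res J c c.
Proof. by rewrite /res /= delta_refl group1. Qed.

Lemma residue_res J c : residue r delta J (res J c).
Proof. by exists c. Qed.

Lemma resP J c d : delta c d \in parabolic r J -> res J c = res J d.
Proof.
move=> cdJ; apply/seteqP; split=> e; rewrite /res /=.
  have [|u uJ ->] := @delta_coset J d c e; last exact: groupM.
  by rewrite deltaV groupV.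
by have [u uJ ->] := delta_coset e cdJ; apply: groupM.
Qed.

Lemma residue_eq J R c : residue r delta J R -> R c -> R = res J c.
Proof. by move=> [d ->] /resP. Qed.

Lemma residue_delta J R a b :
  residue r delta J R -> R a -> R b -> delta a b \in parabolic r J.
Proof. by move=> hR Ra; rewrite (residue_eq hR Ra). Qed.

Lemma residue_neq0 J R : residue r delta J R -> exists c, R c.
Proof. by case=> c ->; exists c; apply: mem_res. Qed.

Lemma res_sub J R L c : residue r delta J R -> R c -> L \subset J -> res L c `<=` R.
Proof.
move=> hR Rc LJ; rewrite (residue_eq hR Rc) => d.
exact: (fintype.subsetP (genS (imsetS _ LJ))).
Qed.

Lemma residue_meet J L R x c : residue r delta J R -> residue r delta L x ->
  R c -> x c -> x `&` R = res (L :&: J) c.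
Proof.
move=> hR hx Rc xc; rewrite (residue_eq hR Rc) (residue_eq hx xc) /res.
by apply/seteqP; split=> d /=; rewrite (parabolicI hW) inE => /andP.
Qed.

(** Since l(w_J) = l(u^-1) + l(u w_J), stepping from [b] by [u] reaches a chamber
    that is opposite [c]. *)
Lemma move_opposite J b c u : u \in parabolic r J ->
  delta b c = u * longest r J ->
  exists b', delta b b' = u /\ delta b' c = longest r J.
Proof.
move=> uJ bc; have [b' bb'] := delta_surj b u; exists b'; split=> //.
have b'b : delta b' b = u^-1 by rewrite deltaV bb'.
rewrite (@deltaM b' b c) b'b bc mulKg //.
by have := longest_split hW (groupVr uJ); rewrite invgK.
Qed.

(** * Singular hyperplanes *)

Section Opposition.
Variables (J L : {set I}) (R xs : set D).
Hypothesis hxs : points (dual_shadow r delta J R L) xs.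

(** If a chamber of [x] is opposite [c], moving to another chamber of [x] changes
    the distance by W_{J - L} on the left, which is an element of
    W_{J - opp_J(L)} on the right and can be undone within [xs].  Conversely an
    opposition to another chamber of [xs] is undone within [x]. *)
Lemma sing_hypP c x : xs c -> points (shadow r delta J R L) x ->
  sing_hyp r delta J R L xs x <->
  (forall b, x b -> delta b c <> longest r J).
Proof.
case: hxs => res_xs xsR xs_c [res_x xR].
have LJ : parabolic r (J :\: L) \subset parabolic r J.
  by apply/genS/imsetS/finset.subsetDl.
split=> [[_ [b [xb [Rb near_b]]]] b' xb' b'c|far_x].
  apply: near_b; split=> //.
  have [u uL bc] := delta_coset c (residue_delta res_x xb xb').
  have [||c' [cc' c'b]] := @move_opposite J c b ((u^-1) ^ longest r J).
  - rewrite groupJ ?longest_parabolic // groupV.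
    exact: (fintype.subsetP LJ).
  - by rewrite deltaV bc b'c invMg conjgE longestV // !mulgA (longestK hW).
  exists c'; last by rewrite deltaV c'b (longestV hW).
  rewrite (residue_eq res_xs xs_c) /res /= cc' (conj_longest_parabolic hW).
  by rewrite groupV.
split; first by split.
have [b xb] := residue_neq0 res_x; exists b; split=> //; split; first exact: xR.
case=> _ [d xs_d bd].
have [v vL cb] := delta_coset b (residue_delta res_xs xs_c xs_d).
have bc : delta b c = longest r J * v^-1.
  by rewrite deltaV cb invMg -deltaV bd.
have := conj_longest_parabolic hW J L (v^-1 ^ longest r J).
rewrite -conjgM -{1}(longestV hW) mulVg conjg1 groupV vL => /esym uL.
have [||b' [bb' b'c]] := @move_opposite J b c (v^-1 ^ longest r J).
- exact: (fintype.subsetP LJ).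
- by rewrite bc conjgE longestV // !mulgA (longestK hW).
by apply: (far_x b') => //; rewrite (residue_eq res_x xb) /res /= bb'.
Qed.

End Opposition.

(** * Points of the shadow space that meet a residue *)

Section Residue.
Variables (K J : {set I}) (R : set D).
Hypothesis hR : residue r delta J R.

Local Notation subpoints := (points (subshadow r delta K R)).
Local Notation respoints := (points (shadow r delta J R (K :&: J))).

Lemma cotypeI : ([set: I] :\: K)%SET :&: J = (J :\: (K :&: J))%SET.
Proof.
apply/finset.setP => i; rewrite !inE /=.
by case: (i \in K); case: (i \in J).
Qed.

Lemma cut_res x a : subpoints x -> x a -> R a -> cut R x = res (J :\: (K :&: J)) a.
Proof.
by move=> [[hx _] _] xa Ra; rewrite /cut (residue_meet hR hx Ra xa) cotypeI.
Qed.

Lemma subpoints_res a : R a -> subpoints (res ([set: I] :\: K)%SET a).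
Proof.
move=> Ra; split; first by split=> //; apply: residue_res.
by exists a; split=> //; apply: mem_res.
Qed.

Lemma cut_points x : subpoints x -> respoints (cut R x).
Proof.
move=> /[dup] Px [_ [a [xa Ra]]]; rewrite (cut_res Px xa Ra).
split; first exact: residue_res.
by apply: (res_sub hR Ra); apply: finset.subsetDl.
Qed.

Lemma cut_inj : {in subpoints &, injective (cut R)}.
Proof.
move=> x y /set_mem [[hx _] [a [xa Ra]]] /set_mem [[hy _] _] eq_xy.
have [ya _] : cut R y a by rewrite -eq_xy.
by rewrite (residue_eq hx xa) (residue_eq hy ya).
Qed.

Lemma cut_surj y a : respoints y -> y a ->
  cut R (res ([set: I] :\: K)%SET a) = y.
Proof.
move=> [hy yR] ya; rewrite (residue_eq hy ya).
exact: cut_res (subpoints_res (yR a ya)) (mem_res _ _) (yR a ya).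
Qed.

Lemma cutK x : subpoints x -> uncut r delta K R (cut R x) = x.
Proof. by move=> Px; apply: (pinvKV _ cut_inj); apply: mem_set. Qed.

Lemma uncutP y : respoints y ->
  subpoints (uncut r delta K R y) /\ cut R (uncut r delta K R y) = y.
Proof.
move=> Py; have [a ya] := residue_neq0 (proj1 Py).
rewrite -(cut_surj Py ya) cutK //; first by split=> //; apply: subpoints_res; case: Py => _; apply.
by apply: subpoints_res; case: Py => _; apply.
Qed.

(** The element w_J w_I is the shortest one of its coset W_J w_J w_I. *)
Lemma wlen_gate v : v \in parabolic r J ->
  wlen r (v * (longest r J * longest r [set: I]%SET)) =
  wlen r v + wlen r (longest r J * longest r [set: I]%SET).
Proof.
move=> vJ; have w0J := longest_parabolic r J.
have inT w : w \in parabolic r [set: I]%SET by apply: mem_parabolicT (cox_gen hW) _.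
have := longest_split hW (inT (longest r J * v^-1)).
have := longest_split hW (inT (longest r J)).
have := longest_split hW (groupVr vJ).
rewrite !invMg !invgK (longestV hW) !mulgA -(wlenV hW (longest r J * v^-1)).
rewrite invMg invgK longestV // wlenV // => eqJ eqI eqvI; apply/eqP.
rewrite -(eqn_add2l (wlen r (v * longest r J))) eqvI -eqI -eqJ.
by rewrite -addnA addnCA addnA [in X in X + _]addnC.
Qed.

(** The chamber [c] is the one of [R] nearest to [d], and distances to [d] are
    distances to [c] followed by w_J w_I. *)
Lemma opposite_gate c d b : R c -> R b ->
  delta c d = longest r J * longest r [set: I]%SET ->
  delta b d = longest r [set: I]%SET <-> delta b c = longest r J.
Proof.
move=> Rc Rb cd; have bcJ := residue_delta hR Rb Rc.
rewrite (@deltaM b c d) cd ?wlen_gate // mulgA.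
split=> [/eqP|->]; last by rewrite -{1}(longestV hW) mulVg mul1g.
rewrite -{2}(mul1g (longest r [set: I]%SET)) (inj_eq (mulIg _)).
by rewrite -[X in _ * X](longestV hW) -eq_mulgV1 => /eqP.
Qed.

Lemma extend_dual_point pR : points (dual_shadow r delta J R (K :&: J)) pR ->
  exists2 p : set D,
    points (dual_shadow r delta [set: I]%SET setT K) p &
    cut R @` (subpoints `&` sing_hyp r delta [set: I]%SET setT K p) =
    sing_hyp r delta J R (K :&: J) pR.
Proof.
move=> hpR; have [c pRc] := residue_neq0 (proj1 hpR).
have Rc : R c by apply: (proj2 hpR).
have [d cd] := delta_surj c (longest r J * longest r [set: I]%SET).
exists (res ([set: I] :\: opp_types r [set: I] K)%SET d).
  by split=> //; apply: residue_res.
set p := res _ d; have hp : points (dual_shadow r delta [set: I]%SET setT K) p.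
  by split=> //; apply: residue_res.
have pd : p d by apply: mem_res.
apply/seteqP; split=> [_ [x [Px Hx] <-]|y Hy].
  have [[hx _] _] := Px.
  have := proj1 (sing_hypP hp pd (conj hx (@subsetT _ x))) Hx.
  move=> far_x; apply/(sing_hypP hpR pRc (cut_points Px)) => b [xb Rb].
  by move/(opposite_gate Rc Rb cd); apply: far_x.
have Py : respoints y by case: Hy.
have far_y := proj1 (sing_hypP hpR pRc Py) Hy.
have [a ya] := residue_neq0 (proj1 Py); have Ra : R a by apply: (proj2 Py).
exists (res ([set: I] :\: K)%SET a); last exact: cut_surj.
split; first exact: subpoints_res.
have Px : points (shadow r delta [set: I]%SET setT K) (res ([set: I] :\: K)%SET a).
  by split=> //; apply: residue_res.
(* Suppose a chamber of the point of Gamma containing [a] were opposite [d].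
   Then delta a c * w_J, which lies in W_J, also lies in W_{I - K}, so stepping
   from [a] by it one stays in [y] and comes to a chamber opposite [c]. *)
apply/(sing_hypP hp pd Px) => b xb bd.
have [u uK ad] := delta_coset d xb.
have acJ := residue_delta hR Ra Rc.
have acE : delta a c * longest r J = u.
  apply: (mulIg (longest r [set: I]%SET)).
  by rewrite -mulgA -cd -deltaM ?ad ?bd // cd wlen_gate.
have uJ : u \in parabolic r J by rewrite -acE groupM // longest_parabolic.
have [||b' [ab' b'c]] := @move_opposite J a c u => //.
  by rewrite -acE longestK.
apply: (far_y b') => //; rewrite (residue_eq (proj1 Py) ya) /res /= ab'.
by rewrite -cotypeI parabolicI // inE uK.
Qed.

(** The point containing a chamber of [R] opposite one of [pR]. *)
Lemma sing_hyp_proper pR : points (dual_shadow r delta J R (K :&: J)) pR ->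
  exists2 y, respoints y & ~ sing_hyp r delta J R (K :&: J) pR y.
Proof.
move=> hpR; have [c pRc] := residue_neq0 (proj1 hpR).
have [b cb] := delta_surj c (longest r J).
have Rb : R b.
  have Rc : R c by apply: (proj2 hpR).
  by rewrite (residue_eq hR Rc) /res /= cb longest_parabolic.
have Py := cut_points (subpoints_res Rb); exists (cut R (res ([set: I] :\: K)%SET b)) => //.
case/(sing_hypP hpR pRc Py)/(_ b); first by split=> //; apply: mem_res.
by rewrite deltaV cb longestV.
Qed.

Lemma line_uncut M : lines (shadow r delta J R (K :&: J)) M ->
  lines (Gamma r delta K) (uncut r delta K R @` M) /\
  uncut r delta K R @` M `<=` subpoints.
Proof.
move=> [l [pi [lKJ hpi piR ->]]]; move: lKJ; rewrite inE => /andP [lK lJ].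
split=> [|_ [y [Py _] <-]]; last by case: (uncutP Py).
exists l, pi; split=> //; apply/seteqP; split=> [_ [y [Py [a [ya pia]]] <-]|x [Px [a [xa pia]]]].
  have [[Px _] cutx] := uncutP Py; split=> //; exists a; split=> //.
  by have [] : cut R (uncut r delta K R y) a by rewrite cutx.
have Ra := piR a pia.
have Px' : subpoints x by split=> //; exists a.
exists (cut R x); last exact: cutK.
by split; [exact: cut_points | exists a; split].
Qed.

End Residue.

End Buildings.

(** * Subspaces and hyperplanes over a division ring *)

Section LinearAlgebra.
Local Open Scope ring_scope.
Import GRing.Theory.
Variables (F : unitRingType) (V : lmodType F).
Implicit Types (A E U : set V) (u v w : V).
Local Notation span := Defs.span.

Lemma span_subspace A : is_subspace (span A).
Proof.
split=> [U [[U0 _] _]|a u v Au Av U /[dup] UA [[_ UL] _]]; first exact: U0.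
by apply: UL; [apply: Au | apply: Av].
Qed.

Lemma span_line_space2 E Y : is_subspace E -> space2 Y ->
  (forall X, space1 X -> X `<=` Y -> X `<=` E) -> Y `<=` E.
Proof.
move=> [E0 _] [u1 [u2 [_ _ YE]]] linesE v Yv.
have [->|v0] := eqVneq v 0; first exact: E0.
have vX : [set v] `<=` Y by move=> _ ->.
apply: (linesE (span [set v])); first by exists v.
  by apply: smallest_sub vX; rewrite YE; apply: span_subspace.
exact: sub_gen_smallest.
Qed.

Lemma span_add_vector U v : is_subspace U ->
  span (U `|` [set v]) = [set a *: v + u | a in setT & u in U].
Proof.
move=> [U0 UL]; apply/seteqP; split=> [|_ [a _ [u Uu <-]]].
  apply: smallest_sub.
    split=> [|a _ _ [b _ [u Uu <-]] [c _ [w Uw <-]]].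
      by exists 0 => //; exists 0; rewrite // scale0r add0r.
    exists (a * b + c) => //; exists (a *: u + w); first exact: UL.
    by rewrite scalerDr scalerA scalerDl addrACA.
  move=> w [Uw|->]; first by exists 0 => //; exists w; rewrite // scale0r add0r.
  by exists 1 => //; exists 0; rewrite // scale1r addr0.
have [_ spanL] := span_subspace (U `|` [set v]).
by apply: spanL; apply: sub_gen_smallest; [right | left].
Qed.

Lemma hyperplane_restrict E U : division_ring F -> is_subspace E ->
  is_hyperplane setT U -> ~ (E `<=` U) -> is_hyperplane E (U `&` E).
Proof.
move=> divF Esub [Usub _ [v0 _ spanT]] /existsNP [v /not_implyP [Ev Uv]].
have [[E0 EL] [U0 UL]] := (Esub, Usub).
have UEsub : is_subspace (U `&` E).
  by split=> [|a u w [Uu Eu] [Uw Ew]]; split=> //; [apply: UL | apply: EL].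
split=> //.
exists v; first by split=> // UEv; apply: Uv; case: UEv.
rewrite span_add_vector //.
apply/seteqP; split=> [_ [a _ [u [_ Eu] <-]]|w Ew]; first exact: EL.
have coord z : exists a u, U u /\ a *: v0 + u = z.
  have : span (U `|` [set v0]) z by rewrite spanT.
  by rewrite span_add_vector // => -[a _ [u Uu <-]]; exists a, u.
have [b [u1 [Uu1 wE]]] := coord w; have [a [u0 [Uu0 vE]]] := coord v.
have a0 : a != 0 by apply/eqP => a0; apply: Uv; rewrite -vE a0 scale0r add0r.
(* The combination that eliminates [v0] from [w] and [v]. *)
have UwE : w - (b / a) *: v = - (b / a) *: u0 + u1.
  rewrite -vE -wE scalerDr scalerA divrK ?divF // opprD.
  by rewrite addrACA subrr add0r addrC scaleNr.
exists (b / a) => //; exists (w - (b / a) *: v); last by rewrite addrC subrK.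
split; first by rewrite UwE; apply: UL.
by rewrite -scaleNr addrC; apply: EL.
Qed.

End LinearAlgebra.

(** * Restricting an embedding to a residue *)

Section Polarized.
Variables (I : finType) (W : finGroupType) (r : I -> W).
Variables (D : Type) (adj : I -> D -> D -> Prop) (delta : D -> D -> W).
Hypotheses (hW : coxeter_system r) (hD : building r adj delta).
Variables (K J : {set I}) (R : set D).
Hypothesis hR : residue r delta J R.
Variables (F : unitRingType) (V : lmodType F) (e : set D -> set V).

Local Notation subpoints := (points (subshadow r delta K R)).
Local Notation respoints := (points (shadow r delta J R (K :&: J))).
Local Notation uncutR := (uncut r delta K R).
Local Notation VR := (image_span subpoints e).

Lemma uncut_image : uncutR @` respoints = subpoints.
Proof.
apply/seteqP; split=> [_ [y /(uncutP hW hD hR) [Px _] <-] //|x Px].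
by exists (cut R x); [exact: (cut_points hW hD hR) | exact: (cutK hW hD)].
Qed.

(** A line of the shadow space of [R] comes from a panel inside [R], so every
    point of the corresponding line of Gamma meets [R]; this is why the image
    line stays inside the span of the points meeting [R]. *)
Lemma full_embedding_residue : full_embedding (Gamma r delta K) setT e ->
  full_embedding (shadow r delta J R (K :&: J)) VR (e \o uncutR).
Proof.
move=> [_ e_pts e_inj _ e_lines].
have VRsub : is_subspace VR by apply: span_subspace.
have e_VR x : subpoints x -> e x `<=` VR.
  by move=> Px v ev; apply: sub_gen_smallest; exists x.
split=> //.
- move=> y /(uncutP hW hD hR) [/[dup] /e_VR eVR [Px _] _].
  by split=> //; have [] := e_pts _ Px.
- move=> y1 y2 /set_mem /(uncutP hW hD hR) [[P1 _] cut1].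
  move=> /set_mem /(uncutP hW hD hR) [[P2 _] cut2] /= e12.
  by rewrite -cut1 -cut2; congr (cut R _); apply: e_inj; rewrite ?mem_set.
- by rewrite /image_span -uncut_image bigcup_image.
move=> M /(line_uncut hW hD hR) [/e_lines [Y [Y2 _ eM]] Msub].
rewrite image_comp in eM; exists Y; split=> //.
apply: (span_line_space2 VRsub Y2) => X X1 XY.
have: [set X | space1 X /\ X `<=` Y] X by split.
by rewrite -eM => -[y My <-]; apply: e_VR; apply: Msub; exists y.
Qed.

Lemma polarized_residue : division_ring F ->
  polarized r delta [set: I]%SET setT K setT e ->
  polarized r delta J R (K :&: J) VR (e \o uncutR).
Proof.
move=> divF [e_full e_pol]; split; first exact: full_embedding_residue.
move=> pR hpR; have [p hp Hp] := extend_dual_point hW hD hR hpR.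
have [U hypU HU] := e_pol p hp.
have VRsub : is_subspace VR by apply: span_subspace.
have e_VR x : subpoints x -> e x `<=` VR.
  by move=> Px v ev; apply: sub_gen_smallest; exists x.
have HpR y : sing_hyp r delta J R (K :&: J) pR y <->
    respoints y /\ e (uncutR y) `<=` U.
  rewrite -Hp HU; split=> [[x [Px [_ exU]] <-]|[Py eyU]].
    by rewrite (cutK hW hD Px); split=> //; apply: (cut_points hW hD hR).
  have [Px cutx] := uncutP hW hD hR Py; exists (uncutR y) => //.
  by split=> //; split=> //; case: Px.
exists (U `&` VR).
  apply: hyperplane_restrict => // VRU.
  have [y Py] := sing_hyp_proper hW hD hR hpR; apply; apply/HpR; split=> //.
  by apply: subset_trans VRU; apply: e_VR; case: (uncutP hW hD hR Py).
apply/seteqP; split=> y.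
  move=> /HpR [Py eyU]; split=> //= v ev; split; first exact: eyU.
  by move: v ev; apply: e_VR; case: (uncutP hW hD hR Py).
by case=> Py eyU; apply/HpR; split=> // v /eyU [].
Qed.

End Polarized.

Theorem theorem2 (I : finType) (W : finGroupType) (r : I -> W)
    (D : Type) (adj : I -> D -> D -> Prop) (delta : D -> D -> W)
    (K J : {set I}) (R : set D)
    (hW : coxeter_system r) (hrank : 2 <= #|I|)
    (hD : building r adj delta)
    (hK : K != finset.set0) (hR : residue r delta J R) :
  (* (a) *)
  (forall pR : set D,
     points (dual_shadow r delta J R (K :&: J)) pR ->
     exists2 p : set D,
       points (dual_shadow r delta [set: I]%SET setT K) p &
       cut R @` (points (subshadow r delta K R)
                 `&` sing_hyp r delta [set: I]%SET setT K p) =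
       sing_hyp r delta J R (K :&: J) pR)
  /\
  (* (b) *)
  (forall (F : unitRingType) (V : lmodType F) (e : set D -> set V),
     division_ring F ->
     polarized r delta [set: I]%SET setT K setT e ->
     polarized r delta J R (K :&: J)
       (image_span (points (subshadow r delta K R)) e)
       (e \o uncut r delta K R)).
Proof.
split=> [pR|F V e]; first exact: (extend_dual_point hW hD hR).
exact: (polarized_residue hW hD hR).
Qed.
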